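(* There is an absolute constant $c>0$ such that for every $n\ge 3$ there exists a set $S$ of $n$ points in the plane, no three of which are collinear, such that the number of triangles with vertices in $S$ whose area equals the minimum area among all triangles with vertices in $S$ is at least $c\, n\log n$.
   Context: A triangle spanned by $S$ is an unordered triple of points of $S$. *)

(* Defs.v *)
From mathcomp Require Import all_boot all_order all_algebra.
From mathcomp Require Import finmap.
From mathcomp Require Import reals.
From mathcomp Require Import ring.

Set Implicit Arguments.
Unset Strict Implicit.
Unset Printing Implicit Defensive.

Import Order.TTheory GRing.Theory Num.Theory.
Local Open Scope fset_scope.
Local Open Scope ring_scope.

Section Plane.
Variable R : realType.

Definition on_line (a b c : R) (p : R * R) : Prop := a * p.1 + b * p.2 = c.

Definition collinear (p q r : R * R) : Prop :=
  exists a b c : R, (a, b) <> (0, 0) /\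
    [/\ on_line a b c p, on_line a b c q & on_line a b c r].

Definition no_three_collinear (S : {fset R * R}) : Prop :=
  forall p q r, p \in S -> q \in S -> r \in S ->
    p != q -> p != r -> q != r -> ~ collinear p q r.

(* Area of the triangle pqr, by the shoelace formula. *)
Definition area3 (p q r : R * R) : R :=
  `|(q.1 - p.1) * (r.2 - p.2) - (r.1 - p.1) * (q.2 - p.2)| / 2.

Definition triangles (S : {fset R * R}) : {fset {fset R * R}} :=
  [fset T in fpowerset S | #|` T| == 3%N].

(* [enum_fset T] lists the vertices in an unspecified order, which is harmless
   since [area3] is symmetric: see [areaE]. Meaningful when [#|` T| = 3]. *)
Definition area (T : {fset R * R}) : R :=
  let v := nth (0, 0) (enum_fset T) in area3 (v 0%N) (v 1%N) (v 2%N).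

Definition min_area_triangles (S : {fset R * R}) : {fset {fset R * R}} :=
  [fset T in triangles S | all (fun U => area T <= area U) (triangles S)].

Lemma area3C12 p q r : area3 p q r = area3 q p r.
Proof. by rewrite /area3 -normrN; congr (`|_| / 2); ring. Qed.

Lemma area3C23 p q r : area3 p q r = area3 p r q.
Proof. by rewrite /area3 -normrN; congr (`|_| / 2); ring. Qed.

Lemma areaE p q r : p != q -> p != r -> q != r ->
  area [fset p; q; r] = area3 p q r.
Proof.
move=> pq pr qr; rewrite /area.
set T := [fset p; q; r].
have T3 : perm_eq (enum_fset T) [:: p; q; r].
  apply: uniq_perm; first exact: fset_uniq.
    by rewrite /= !inE negb_or pq pr qr.
  move=> x; have -> : (x \in enum_fset T) = (x \in T) by [].
  by rewrite !inE orbA.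
have uT := perm_uniq T3; have mT := perm_mem T3; have := perm_size T3.
move: uT mT; rewrite /= !inE negb_or pq pr qr.
case: (enum_fset T) => [|a [|b [|c [|]]]] //= uT mT _.
move: uT; rewrite !inE negb_or andbT => /andP[/andP[ab ac] bc].
have := mT a; have := mT b; have := mT c; rewrite !inE !eqxx ?orbT /=.
move=> /esym/or3P hc /esym/or3P hb /esym/or3P ha.
case: ha => /eqP ea; case: hb => /eqP eb; case: hc => /eqP ec; subst a b c;
  rewrite ?eqxx // in ab ac bc *;
  by [ rewrite area3C23 | rewrite area3C12 | rewrite area3C12 area3C23
     | rewrite area3C23 area3C12 | rewrite area3C12 area3C23 area3C12 ].
Qed.

End Plane.

(* Main.v *)
(* Normalise the minimum area to 1/2.  Given a configuration A in which every
   triangle has area at least 1/2, replace it by the Minkowski sum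
   A + {0, a, b, a + b} with a = (s, s^2) and b = 3 a + (0, 1/s), so that
   {0, a, b, a + b} has area 1.  The doubled area of a triangle in the sum is a
   polynomial in s (up to a bounded term), which is constant only if the
   triangle lies in a translate of A or of the parallelogram; hence for s large
   no area drops below 1/2.  The number n of points is multiplied by 4, while
   the number N of triangles of area 1/2 becomes at least 4 N + n, which yields
   order n log n after iteration.  Points (s, s^2) with s large can be added to
   reach an arbitrary number of points. *)
Require Import Defs.
From mathcomp Require Import all_boot all_order all_algebra.
From mathcomp Require Import finmap.
From mathcomp Require Import reals exp.
From mathcomp Require Import ring lra zify.

Import Order.TTheory GRing.Theory Num.Theory.
Local Open Scope fset_scope.
Local Open Scope ring_scope.

(** * Lower bounds valid for all large [s] *)

Section Eventually.
Variable R : realType.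

Lemma eventually_forall (I : finType) (P : I -> R -> Prop) :
  (forall i, exists s0, forall s, s0 <= s -> P i s) ->
  exists s0, forall s, s0 <= s -> forall i, P i s.
Proof.
(* The sum of absolute values dominates each of the finitely many thresholds. *)
move=> /fin_all_exists[f fP]; exists (\sum_i `|f i|) => s les i.
apply: fP; apply: le_trans les; rewrite (bigD1 i) //=.
by apply: (le_trans (ler_norm _)); rewrite lerDl sumr_ge0.
Qed.

(** For [s >= 1] the tail [c + z / s] is at most [|c| + |z|], while the part in [x] and [y] is
    unbounded. The shape is that of the expansions of [det3] in [s] below. *)
Lemma eventually_norm_ge1 (x y c z : R) : (x != 0) || (y != 0) ->
  exists s0, forall s, s0 <= s -> 1 <= `|x * s ^+ 2 - y * s + c + z / s|.
Proof.
move=> xy.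
have tail s : 1 <= s -> `|c + z / s| <= `|c| + `|z|.
  move=> s1; apply: (le_trans (ler_normD _ _)); rewrite lerD2l normrM.
  rewrite ler_piMr // normfV invf_le1 ?normr_gt0 ?gt_eqF ?(lt_le_trans ltr01) //.
  by rewrite (le_trans s1) ?ler_norm.
have main s (u : R) : 1 <= s -> 1 + `|c| + `|z| <= `|u| -> 1 <= `|u + c + z / s|.
  move=> s1 hu; rewrite -addrA.
  have := lerB_dist u (- (c + z / s)); rewrite opprK normrN => h.
  apply: le_trans h; have := tail _ s1; lra.
have [x0|x0] := eqVneq x 0.
  move: xy; rewrite x0 eqxx /= => y0.
  exists (1 + (1 + `|c| + `|z|) / `|y|) => s les.
  have ypos : 0 < `|y| by rewrite normr_gt0.
  have q0 : 0 <= (1 + `|c| + `|z|) / `|y| by rewrite divr_ge0 // !addr_ge0.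
  apply: main; first lra.
  rewrite mul0r add0r normrN normrM mulrC -ler_pdivrMr //.
  apply: le_trans (ler_norm _); lra.
exists (1 + (1 + `|c| + `|z|) + (`|y| + 1) / `|x|) => s les.
have xpos : 0 < `|x| by rewrite normr_gt0.
have q0 : 0 <= (`|y| + 1) / `|x| by rewrite divr_ge0 // addr_ge0.
have c0 := normr_ge0 c; have z0 := normr_ge0 z.
have s1 : 1 <= s by lra.
apply: main => //.
(* Factoring out [s] reduces the quadratic case to [|x * s - y| >= 1], as [s] itself is large
   enough. *)
have -> : x * s ^+ 2 - y * s = (x * s - y) * s by ring.
rewrite normrM (ger0_norm (le_trans ler01 s1)).
have h : 1 <= `|x * s - y|.
  have := lerB_dist (x * s) y; apply: le_trans.
  rewrite normrM (ger0_norm (le_trans ler01 s1)).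
  have : `|y| + 1 <= s * `|x| by rewrite -ler_pdivrMr //; lra.
  lra.
apply: (@le_trans _ _ s); first lra.
by rewrite ler_peMl //; lra.
Qed.

End Eventually.

(** * Separated families and their unit triples *)

Section Configurations.
Variable R : realType.
Implicit Types p q r : R * R.

(** Twice the signed area, so area 1/2 means [|det3| = 1]. *)
Definition det3 p q r : R :=
  (q.1 - p.1) * (r.2 - p.2) - (r.1 - p.1) * (q.2 - p.2).

Definition separated {T : finType} (g : T -> R * R) : Prop :=
  forall i j k, i != j -> i != k -> j != k ->
    1 <= `|det3 (g i) (g j) (g k)|.

(** Triples are ordered, so each triangle counts six times; this costs only a constant factor. *)
Definition unit_triples {T : finType} (g : T -> R * R) : {set T * T * T} :=
  [set t | [&& t.1.1 != t.1.2, t.1.1 != t.2, t.1.2 != t.2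
             & `|det3 (g t.1.1) (g t.1.2) (g t.2)| == 1]].

Definition configuration (n N : nat) : Prop :=
  exists (T : finType) (g : T -> R * R),
    [/\ #|T| = n, separated g & (N <= #|unit_triples g|)%N].

(** If two indices shared a point, any third index would give a degenerate triangle. *)
Lemma separated_inj {T : finType} (g : T -> R * R) :
  (2 < #|T|)%N -> separated g -> injective g.
Proof.
move=> T3 sg i j gij; apply/eqP/negPn/negP => ij.
have [k /andP[ki kj]] : exists k, (k != i) && (k != j).
  apply/existsP; apply: contraLR T3 => /existsPn h; rewrite -leqNgt.
  have sub : [set: T] \subset [set i; j].
    by apply/subsetP => k _; have := h k; rewrite !inE negb_and !negbK.
  by rewrite -cardsT; apply: leq_trans (subset_leq_card sub) _; rewrite cards2; case: eqP.
have := sg i j k ij; rewrite eq_sym ki eq_sym kj gij => /(_ isT isT).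
by rewrite /det3 !subrr !mul0r mulr0 subrr normr0 ler10.
Qed.

Lemma configuration_triangle : configuration 3 1.
Proof.
pose g (o : option bool) : R * R :=
  if o is Some b then (if b then (1, 0) else (0, 1)) else (0, 0).
exists (option bool : finType), g; split.
- by rewrite card_option card_bool.
- move=> [[]|] [[]|] [[]|] //= _ _ _; rewrite /det3 /=;
  by rewrite ?(subr0, sub0r, mulr0, mul0r, mul1r, mulr1, mulN1r, mulrN1, opprK,
    addr0, add0r, subrr, normrN, normr1, lexx, oppr0, addrK, addKr).
apply/card_gt0P; exists (None, Some true, Some false).
by rewrite inE /= /det3 /= !subr0 mul0r mulr1 subr0 normr1.
Qed.

(** The determinant of two distinct points and [(s, s^2)] is a polynomial in [s] whose coefficients
    of [s^2] and [s] are, up to sign, the coordinate differences, so they do not both vanish. *)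
Lemma configuration_add_point n N :
  (2 < n)%N -> configuration n N -> configuration n.+1 N.
Proof.
move=> n3 [T [g [Tn sg NT]]].
have ginj : injective g by apply: separated_inj => //; rewrite Tn.
have [s0 s0P] : exists s0 : R, forall s, s0 <= s -> forall t : T * T,
    t.1 != t.2 -> 1 <= `|det3 (g t.1) (g t.2) (s, s ^+ 2)|.
  apply: eventually_forall => -[i j] /=.
  have [->|ij] := eqVneq i j; first by exists 0.
  have [|s0 hs0] := @eventually_norm_ge1 R ((g j).1 - (g i).1) ((g j).2 - (g i).2)
    ((g i).1 * ((g j).2 - (g i).2) - ((g j).1 - (g i).1) * (g i).2) 0.
    rewrite -negb_and !subr_eq0; apply: contra ij => /andP[/eqP e1 /eqP e2].
    by apply/eqP/ginj; rewrite [LHS]surjective_pairing -e1 -e2 -surjective_pairing.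
  exists s0 => s /hs0 + _; congr (1 <= `|_|); rewrite /det3 /=; ring.
have {}s0P := s0P s0 (lexx _).
pose h (o : option T) : R * R := if o is Some i then g i else (s0, s0 ^+ 2).
have rot p q r : det3 p q r = det3 q r p by rewrite /det3; ring.
exists (option T : finType), h; split; first by rewrite card_option Tn.
  move=> [i|] [j|] [k|] //= ij ik jk.
  - exact: sg.
  - exact: (s0P (i, j)).
  - by rewrite rot rot; apply: (s0P (k, i)); rewrite eq_sym.
  - by rewrite rot; apply: (s0P (j, k)).
apply: (leq_trans NT).
pose f (t : T * T * T) := (Some t.1.1, Some t.1.2, Some t.2).
have finj : injective f by move=> [[a b] c] [[a' b'] c'] [-> -> ->].
rewrite -(card_imset _ finj); apply: subset_leq_card.
by apply/subsetP => _ /imsetP[t + ->]; rewrite !inE.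
Qed.

(** * Minkowski sum with a parallelogram *)

(* The point p + x a + y b for a = (s, s^2) and b = 3 a + (0, 1/s). *)
Definition shift (s x y : R) p : R * R :=
  (p.1 + (x + 3 * y) * s, p.2 + (x + 3 * y) * s ^+ 2 + y / s).

(** Up to [(0, y / s)] all offsets are multiples of [(s, s^2)], so the cubic terms cancel. The
    bounded term gains the determinant of the coefficient vectors because [a] and [b] have
    determinant 1. *)
Lemma det3_shift s x1 y1 x2 y2 x3 y3 p q r : s != 0 ->
  det3 (shift s x1 y1 p) (shift s x2 y2 q) (shift s x3 y3 r) =
  let t2 := x2 - x1 + 3 * (y2 - y1) in
  let t3 := x3 - x1 + 3 * (y3 - y1) in
  (t3 * (q.1 - p.1) - t2 * (r.1 - p.1)) * s ^+ 2
  - (t3 * (q.2 - p.2) - t2 * (r.2 - p.2)) * s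
  + (det3 p q r + ((x2 - x1) * (y3 - y1) - (x3 - x1) * (y2 - y1)))
  + ((y3 - y1) * (q.1 - p.1) - (y2 - y1) * (r.1 - p.1)) / s.
Proof. by move=> s0; rewrite /det3 /shift /=; field. Qed.

Definition minkowski {T : finType} (g : T -> R * R) s (i : T * (bool * bool)) :=
  shift s i.2.1%:R i.2.2%:R (g i.1).

(* The factor 3 in b makes the offsets 0, 1, 3, 4 along a distinct. *)
Lemma shift_offset_eq0 (u v : bool * bool) :
  v.1%:R - u.1%:R + 3 * (v.2%:R - u.2%:R) = 0 :> R -> u = v.
Proof. by case: u v => [[] []] [[] []] //= h; exfalso; move: h; lra. Qed.

Lemma unit_square_det (u v w : bool * bool) : u != v -> u != w -> v != w ->
  `|(v.1%:R - u.1%:R) * (w.2%:R - u.2%:R)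
    - (w.1%:R - u.1%:R) * (v.2%:R - u.2%:R)| = 1 :> R.
Proof.
case: u v w => [[] []] [[] []] [[] []] //= _ _ _;
  by rewrite ?(subr0, sub0r, mulr0, mul0r, mul1r, mulr1, mulN1r, mulrN1, opprK,
    addr0, add0r, subrr, normrN, normr1, oppr0, addrK, addKr).
Qed.

Lemma separated_minkowski (T : finType) (g : T -> R * R) :
  injective g -> separated g ->
  exists s0 : R, forall s, s0 <= s -> separated (minkowski g s).
Proof.
move=> ginj sg; set T' := (T * (bool * bool))%type.
suff [s0 h] : exists s0 : R, forall s, s0 <= s -> forall t : T' * T' * T',
    t.1.1 != t.1.2 -> t.1.1 != t.2 -> t.1.2 != t.2 ->
    1 <= `|det3 (minkowski g s t.1.1) (minkowski g s t.1.2) (minkowski g s t.2)|.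
  by exists s0 => s /h{}h i j k; apply: (h (i, j, k)).
apply: eventually_forall => -[[[i u] [j v]] [k w]] /=.
set t2 : R := v.1%:R - u.1%:R + 3 * (v.2%:R - u.2%:R).
set t3 : R := w.1%:R - u.1%:R + 3 * (w.2%:R - u.2%:R).
set X := t3 * ((g j).1 - (g i).1) - t2 * ((g k).1 - (g i).1).
set Y := t3 * ((g j).2 - (g i).2) - t2 * ((g k).2 - (g i).2).
(* Up to sign, [X] and [Y] are the coefficients of [s^2] and [s] in [det3_shift]. *)
have [XY|] := boolP ((X != 0) || (Y != 0)).
  have [s0 hs0] := @eventually_norm_ge1 R X Y (det3 (g i) (g j) (g k) +
    ((v.1%:R - u.1%:R) * (w.2%:R - u.2%:R) - (w.1%:R - u.1%:R) * (v.2%:R - u.2%:R)))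
    ((w.2%:R - u.2%:R) * ((g j).1 - (g i).1) - (v.2%:R - u.2%:R) * ((g k).1 - (g i).1)) XY.
  exists (1 + `|s0|) => s les _ _ _.
  rewrite /minkowski det3_shift /=; last by rewrite gt_eqF // (lt_le_trans _ les) ?ltr_pwDl.
  by apply: hs0; rewrite (le_trans _ les) // (le_trans (ler_norm _)) // lerDr.
rewrite negb_or !negbK => /andP[/eqP X0 /eqP Y0].
have neq a b : a != b -> ((g a).1 - (g b).1 != 0) || ((g a).2 - (g b).2 != 0).
  move=> ab; rewrite -negb_and !subr_eq0; apply: contra ab => /andP[/eqP e1 /eqP e2].
  by apply/eqP/ginj; rewrite [LHS]surjective_pairing e1 e2 -surjective_pairing.
(* The quadratic and linear terms vanish: the three points come from a common
   translate of [g] or of the parallelogram. *)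
exists 1 => s s1 iu_jv iu_kw jv_kw.
have s0 : s != 0 by rewrite gt_eqF // (lt_le_trans ltr01).
have cancel2 t a b : a != b -> t * ((g a).1 - (g b).1) = 0 ->
    t * ((g a).2 - (g b).2) = 0 -> t = 0.
  move=> /neq/orP[] n0 /eqP h1 /eqP h2; apply/eqP; move: h1 h2;
  by rewrite !mulf_eq0 (negPf n0) !orbF.
have [ij|ij] := eqVneq i j.
  have [ik|ik] := eqVneq i k.
    subst j k; move: iu_jv iu_kw jv_kw; rewrite !xpair_eqE eqxx /= => uv uw vw.
    rewrite /minkowski det3_shift //= /det3.
    by rewrite !subrr !(mulr0, oppr0, mul0r, subr0, add0r, addr0) unit_square_det.
  (* Exactly two indices agree here and in the next two cases: the vanishing terms force equal
     offsets at the shared index, against distinctness. *)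
  subst j; move: iu_jv; rewrite xpair_eqE eqxx /= => /eqP[].
  apply: shift_offset_eq0; apply: (cancel2 _ k i); first by rewrite eq_sym.
    by move: X0; rewrite /X subrr mulr0 sub0r => /eqP; rewrite oppr_eq0 => /eqP.
  by move: Y0; rewrite /Y subrr mulr0 sub0r => /eqP; rewrite oppr_eq0 => /eqP.
have [ik|ik] := eqVneq i k.
  subst k; move: iu_kw; rewrite xpair_eqE eqxx /= => /eqP[].
  apply: shift_offset_eq0; apply: (cancel2 _ j i); first by rewrite eq_sym.
    by move: X0; rewrite /X subrr mulr0 subr0.
  by move: Y0; rewrite /Y subrr mulr0 subr0.
have [jk|jk] := eqVneq j k.
  subst k; move: jv_kw; rewrite xpair_eqE eqxx /= => /eqP[].
  have e : w.1%:R - v.1%:R + 3 * (w.2%:R - v.2%:R) = t3 - t2.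
    by rewrite /t2 /t3; ring.
  apply: shift_offset_eq0; rewrite e; apply: (cancel2 _ j i); first by rewrite eq_sym.
    by rewrite -X0 /X; ring.
  by rewrite -Y0 /Y; ring.
have det_ge1 := sg _ _ _ ij ik jk.
have det_neq0 : det3 (g i) (g j) (g k) != 0.
  by rewrite -normr_gt0 (lt_le_trans ltr01).
(* Eliminating [t3] from [X = Y = 0] leaves [t2] times a nonzero determinant; [t3] is treated alike.
   All three offsets then coincide. *)
have t2_0 : t2 = 0.
  apply: (mulIf det_neq0); rewrite mul0r.
  transitivity (X * ((g j).2 - (g i).2) - Y * ((g j).1 - (g i).1)).
    by rewrite /det3 /X /Y; ring.
  by rewrite X0 Y0 !mul0r subrr.
have t3_0 : t3 = 0.
  apply: (mulIf det_neq0); rewrite mul0r.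
  transitivity (X * ((g k).2 - (g i).2) - Y * ((g k).1 - (g i).1)).
    by rewrite /det3 /X /Y; ring.
  by rewrite X0 Y0 !mul0r subrr.
move: (shift_offset_eq0 _ _ t2_0) (shift_offset_eq0 _ _ t3_0) => uv uw; subst v w.
by rewrite /minkowski det3_shift //= !subrr !(mulr0, mul0r, addr0, subrr, add0r, oppr0).
Qed.

Lemma configuration_quadruple n N :
  (2 < n)%N -> configuration n N -> configuration (4 * n) (4 * N + n).
Proof.
move=> n3 [T [g [Tn sg NT]]].
have ginj : injective g by apply: separated_inj => //; rewrite Tn.
have [s0 s0P] := separated_minkowski _ _ ginj sg.
pose s := 1 + `|s0|.
have s_neq0 : s != 0 by rewrite gt_eqF // ltr_pwDl.
have sep : separated (minkowski g s).
  by apply: s0P; rewrite (le_trans (ler_norm _)) // lerDr.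
exists (T * (bool * bool))%type, (minkowski g s); split => //.
  by rewrite !card_prod card_bool Tn mulnC.
(* [f1] lists the four translates of each old unit triple, [f2] one unit triple in the parallelogram
   at each point. *)
pose f1 (z : (T * T * T) * (bool * bool)) :=
  ((z.1.1.1, z.2), (z.1.1.2, z.2), (z.1.2, z.2)).
pose f2 (i : T) := ((i, (false, false)), (i, (true, false)), (i, (false, true))).
have f1_inj : injective f1.
  by move=> [[[a b] c] u] [[[a' b'] c'] u'] [-> -> -> _ ->].
have f2_inj : injective f2 by move=> i j [].
pose A := f1 @: setX (unit_triples g) [set: bool * bool].
pose B := f2 @: [set: T].
have cA : #|A| = (#|unit_triples g| * 4)%N.
  by rewrite card_imset // cardsX cardsT card_prod card_bool.
have cB : #|B| = n by rewrite card_imset // cardsT.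
(* Triples in [A] carry one common offset, those in [B] three different ones. *)
have AB : A :&: B = set0.
  apply/setP => t; rewrite !inE; apply/negP => /andP[].
  by move=> /imsetP[[[[a b] c] u] _ ->] /imsetP[i _ [_ -> _]].
apply: (@leq_trans #|A :|: B|).
  rewrite cardsU AB cards0 subn0 cA cB leq_add2r mulnC.
  by rewrite leq_mul2r NT orbT.
apply/subset_leq_card/subsetP => t; rewrite inE => /orP[] /imsetP.
  move=> [[[[a b] c] u]]; rewrite !inE andbT /= => /and4P[ab ac bc d] ->.
  rewrite !xpair_eqE (negPf ab) (negPf ac) (negPf bc) /= /minkowski.
  by rewrite det3_shift //= !subrr !(mulr0, mul0r, addr0, subrr, add0r, oppr0).
move=> [i _ ->]; rewrite inE /= !xpair_eqE !eqxx /= /minkowski det3_shift //= /det3.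
by rewrite !subrr !(mulr0, mul0r, addr0, subrr, add0r, oppr0, subr0, mulr1, normr1).
Qed.

(** * From indexed families to point sets *)

(** Differences of the line equations show that [a] and [b] times the determinant vanish, and one of
    [a], [b] is nonzero. *)
Lemma collinear_det3 p q r : collinear p q r -> det3 p q r = 0.
Proof.
move=> [a [b [c [ab [hp hq hr]]]]]; rewrite /on_line in hp hq hr.
have ha : a * det3 p q r = 0.
  have -> : a * det3 p q r =
    ((a * q.1 + b * q.2) - (a * p.1 + b * p.2)) * (r.2 - p.2)
    - ((a * r.1 + b * r.2) - (a * p.1 + b * p.2)) * (q.2 - p.2) by rewrite /det3; ring.
  by rewrite hp hq hr subrr !mul0r subrr.
have hb : b * det3 p q r = 0.
  have -> : b * det3 p q r =
    ((a * r.1 + b * r.2) - (a * p.1 + b * p.2)) * (q.1 - p.1)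
    - ((a * q.1 + b * q.2) - (a * p.1 + b * p.2)) * (r.1 - p.1) by rewrite /det3; ring.
  by rewrite hp hq hr subrr !mul0r subrr.
apply/eqP/negPn/negP => d0; apply: ab.
move/eqP: ha; move/eqP: hb; rewrite !mulf_eq0 (negPf d0) !orbF.
by move=> /eqP-> /eqP->.
Qed.

Lemma separated_no_three_collinear (T : finType) (g : T -> R * R) :
  separated g -> no_three_collinear [fset g i | i in T].
Proof.
move=> sg p q r /imfsetP[i _ ->] /imfsetP[j _ ->] /imfsetP[k _ ->] ij ik jk.
move=> /collinear_det3 d0.
have ne (a b : T) : g a != g b -> a != b by apply: contraNneq => ->.
by have := sg i j k (ne _ _ ij) (ne _ _ ik) (ne _ _ jk); rewrite d0 normr0 ler10.
Qed.

Lemma separated_area_ge (T : finType) (g : T -> R * R) U :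
  separated g -> U \in triangles [fset g i | i in T] -> 1 / 2 <= area U.
Proof.
move=> sg; rewrite !inE /= => /andP[]; rewrite fpowersetE => /fsubsetP sub /eqP U3.
have hS x : x \in enum_fset U -> exists i, x = g i.
  by move=> xU; have /imfsetP[i _ ->] := sub x xU; exists i.
have := fset_uniq U; rewrite /area; move: U3 hS.
case: (enum_fset U) => [|a [|b [|c [|]]]] //= _ hS.
have [i ->] := hS a (mem_head _ _).
have [j ->] : exists j, b = g j by apply: hS; rewrite !inE eqxx orbT.
have [k ->] : exists k, c = g k by apply: hS; rewrite !inE eqxx !orbT.
rewrite !inE negb_or andbT => /andP[/andP[ij ik] jk].
have ne (x y : T) : g x != g y -> x != y by apply: contraNneq => ->.
have := sg i j k (ne _ _ ij) (ne _ _ ik) (ne _ _ jk).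
by rewrite /area3 -/(det3 _ _ _) ler_pM2r ?invr_gt0.
Qed.

Lemma unit_triple_min_area (T : finType) (g : T -> R * R) (t : T * T * T) :
  injective g -> separated g -> t \in unit_triples g ->
  [fset g t.1.1; g t.1.2; g t.2] \in min_area_triangles [fset g i | i in T].
Proof.
case: t => [[i j] k] ginj sg; rewrite inE /= => /and4P[ij ik jk /eqP d1].
have gij : g i != g j by rewrite (inj_eq ginj).
have gik : g i != g k by rewrite (inj_eq ginj).
have gjk : g j != g k by rewrite (inj_eq ginj).
have gS x : g x \in [fset g i | i in T] by apply/imfsetP; exists x.
have tri : [fset g i; g j; g k] \in triangles [fset g i | i in T].
  rewrite !inE /= fpowersetE; apply/andP; split.
    by apply/fsubsetP => x; rewrite !inE => /orP[/orP[]|] /eqP->.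
  by rewrite fsetUC cardfsU1 !inE negb_or ![g k == _]eq_sym gik gjk cardfs2 gij.
rewrite !inE /=; apply/andP; split; first by rewrite !inE in tri.
apply/allP => U /(separated_area_ge _ _ _ sg); apply: le_trans.
by rewrite areaE // /area3 -/(det3 _ _ _) d1.
Qed.

(* A triangle arises from at most 3^3 triples of indices. *)
Lemma unit_triples_leq (T : finType) (g : T -> R * R) :
  injective g -> separated g ->
  (#|unit_triples g| <= 27 * #|` min_area_triangles [fset g i | i in T]|)%N.
Proof.
move=> ginj sg; set M := min_area_triangles _.
pose phi (t : T * T * T) := [fset g t.1.1; g t.1.2; g t.2].
(* Double counting: each triple lies over a member of [M], and after exchanging the sums the fibre
   over [U] lies in the cube of the set [A] of indices of its vertices. *)
have step1 : (#|unit_triples g| <=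
    \sum_(t in unit_triples g) \sum_(U <- enum_fset M) (phi t == U))%N.
  rewrite -sum1_card; apply: leq_sum => t /(unit_triple_min_area _ _ _ ginj sg) tM.
  by rewrite (big_rem (phi t)) //= eqxx.
apply: (leq_trans step1); rewrite exchange_big /= mulnC.
have -> : (#|` M| * 27 = \sum_(U <- enum_fset M) 27)%N.
  by rewrite big_const_seq count_predT iter_addn_0 mulnC.
rewrite big_seq [leqRHS]big_seq; apply: leq_sum => U UM.
have U3 : size (enum_fset U) = 3%N.
  have : U \in M := UM.
  by rewrite !inE /= => /andP[/andP[_ /eqP]].
pose A := [set i | g i \in U].
have A3 : (#|A| <= 3)%N.
  rewrite -U3 cardE -(size_map g); apply: uniq_leq_size.
    by rewrite map_inj_uniq // enum_uniq.
  by move=> _ /mapP[i + ->]; rewrite mem_enum inE.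
rewrite -big_mkcondr /= sum1_card.
apply: (@leq_trans #|setX (setX A A) A|).
  apply/subset_leq_card/subsetP => t; rewrite !inE => /andP[_ /eqP<-].
  by rewrite !inE !eqxx !orbT.
rewrite !cardsX (@leq_mul _ _ 9 3) // (@leq_mul _ _ 3 3) //.
Qed.

Lemma configuration_min_area n N : (2 < n)%N -> configuration n N ->
  exists S : {fset R * R},
    [/\ #|` S| = n, no_three_collinear S
      & (N <= 27 * #|` min_area_triangles S|)%N].
Proof.
move=> n3 [T [g [Tn sg NT]]].
have ginj : injective g by apply: separated_inj => //; rewrite Tn.
exists [fset g i | i in T]; split.
- by rewrite card_imfset //= -cardE Tn.
- exact: separated_no_three_collinear.
- exact: leq_trans NT (unit_triples_leq _ _ ginj sg).
Qed.

(** * Iteration and intermediate numbers of points *)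

(** Starting from 1, the recursion [N' = 4 N + 3 * 4^m] has the solution [4^m (1 + 3 m / 4)]; the
    bound clears its denominator. *)
Lemma configuration_iter m :
  exists2 N, configuration (3 * 4 ^ m) N & (4 ^ m * (3 * m + 4) <= 4 * N)%N.
Proof.
elim: m => [|m [N cN hN]]; first by exists 1%N => //; exact: configuration_triangle.
exists (4 * N + 3 * 4 ^ m)%N; last by rewrite expnS; lia.
have -> : (3 * 4 ^ m.+1 = 4 * (3 * 4 ^ m))%N by rewrite expnS; lia.
by apply: configuration_quadruple => //; have := expn_gt0 4 m; lia.
Qed.

Lemma configuration_add_points k n N :
  (2 < n)%N -> configuration n N -> configuration (n + k) N.
Proof.
move=> n3 cN; elim: k => [|k IHk]; first by rewrite addn0.
by rewrite addnS; apply: configuration_add_point => //; lia.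
Qed.

End Configurations.

Theorem theorem6 (R : realType) :
  exists c : R, 0 < c /\
    forall n : nat, (3 <= n)%N ->
      exists S : {fset R * R},
        [/\ #|` S| = n,
            no_three_collinear S
          & c * n%:R * ln n%:R <= #|` min_area_triangles S|%:R].
Proof.
(* 1944 = 27 * 2 * 12 * 3: the 27 of [unit_triples_leq], 2 N >= 4^m (m + 2),
   n <= 12 * 4^m and ln n <= 3 (m + 2). *)
exists (1944%:R)^-1; split; first by rewrite invr_gt0 ltr0n.
(* [m] is the largest exponent with [3 * 4^m <= n]; the missing points are added one by one. *)
move=> n n3; pose m := trunc_log 4 (n %/ 3).
have /andP[mlo mhi] : (4 ^ m <= n %/ 3 < 4 ^ m.+1)%N.
  by apply: trunc_log_bounds => //; rewrite divn_gt0.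
have nlo : (3 * 4 ^ m <= n)%N by lia.
have nhi : (n <= 12 * 4 ^ m)%N by move: mhi; rewrite expnS; lia.
have m3 : (2 < 3 * 4 ^ m)%N by have := expn_gt0 4 m; lia.
have [N cN hN] := configuration_iter R m.
have cnN : configuration R n N.
  by rewrite -(subnKC nlo); apply: configuration_add_points.
have [S [Sn Scol hS]] := configuration_min_area R n N n3 cnN.
exists S; split => //.
have hln : ln n%:R <= (3 * (m + 2))%:R :> R.
  have n_le : n%:R <= 4 ^+ (m + 2) :> R.
    by rewrite -natrX ler_nat addn2 !expnS; lia.
  have n0 : (0 : R) < n%:R by rewrite ltr0n; lia.
  rewrite natrM mulr_natr.
  apply: (@le_trans _ _ (ln (4 ^+ (m + 2)))).
    by rewrite ler_ln // ?posrE ?exprn_gt0 // ltr0n.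
  rewrite lnXn // lerMn2r; apply/orP; right.
  (* [ln 4 <= 3] is an instance of [ln (1 + x) <= x]. *)
  have -> : 4 = 1 + 3 :> R by lra.
  by apply: le_ln1Dx; lra.
rewrite -mulrA mulrC ler_pdivrMr ?ltr0n //.
apply: (@le_trans _ _ (n%:R * (3 * (m + 2))%:R)); first by rewrite ler_wpM2l.
rewrite -!natrM ler_nat.
apply: (@leq_trans (12 * 4 ^ m * (3 * (m + 2)))); first by rewrite leq_mul2r nhi orbT.
by move: hN hS; set e := (4 ^ m)%N; nia.
Qed.
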